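(* Let $m\ge2$ be an integer, let $X_1,\ldots,X_n$ be i.i.d. random variables with law $P$ taking values in a measurable space $\mathcal{X}$, and let $h:\mathcal{X}^m\to\mathbb{R}$ be a measurable symmetric kernel, with mean $m_h=\mathbb{E}\,h(X_1,\ldots,X_m)$, such that $h-m_h$ is $P$-canonical. Assume that $$M_p:=\left(\mathbb{E}\left[\left|h(X_1,\ldots,X_m)-m_h\right|^p\right]\right)^{1/p}<\infty$$ for some $1<p\le2$. Let $\delta\in(0,\tfrac12)$ be such that $\lceil\log(\delta^{-1})\rceil\le\frac{n}{64m}$. Let $\mathcal{B}$ be a regular partition of $\{1,\ldots,n\}$ with $|\mathcal{B}|=32m\lceil\log(\delta^{-1})\rceil$ blocks. Then, with probability at least $1-2\delta$, $$\left|\overline{U}_{\mathcal{B}}(h)-m_h\right|\le K_m\,M_p\left(\frac{\lceil\log(\delta^{-1})\rceil}{n}\right)^{m(p-1)/p},$$ where $K_m=2^{4m+1}m^{\frac m2}$.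
   Context: Here $\lceil\cdot\rceil$ is the ceiling function and $\log$ is the natural logarithm. Symmetric kernel: $h:\mathcal{X}^m\to\mathbb{R}$ is symmetric if $h(x_1,\ldots,x_m)=h(x_{s_1},\ldots,x_{s_m})$ for all $x_1,\ldots,x_m\in\mathcal{X}$ and all permutations $s$ of $\{1,\ldots,m\}$. $P$-degenerate and $P$-canonical: a symmetric kernel $g$ of $m$ variables is $P$-degenerate of order $q-1$, $1<q\le m$, if for all $x_1,\ldots,x_{q-1}\in\mathcal{X}$, $$\int g(x_1,\ldots,x_m)\,dP^{m-q+1}(x_q,\ldots,x_m)=\int g(x_1,\ldots,x_m)\,dP^m(x_1,\ldots,x_m),$$ and $(x_1,\ldots,x_q)\mapsto\int g(x_1,\ldots,x_m)\,dP^{m-q}(x_{q+1},\ldots,x_m)$ is not constant. It is $P$-canonical if its mean $\int g\,dP^m$ is $0$ and it is $P$-degenerate of order $m-1$ (the case $q=m$, in which the last function is $g$ itself). Regular partition: a partition $\mathcal{B}=(B_1,\ldots,B_V)$ of $\{1,\ldots,n\}$, $V=|\mathcal{B}|\le n$, is regular if $\left||B_K|-\frac nV\right|\le 1$ for all $K=1,\ldots,V$. Block statistics: for blocks $B_{i_1},\ldots,B_{i_m}$ of $\mathcal{B}$, $$U_{B_{i_1},\ldots,B_{i_m}}(h)=\frac{1}{|B_{i_1}|\cdots|B_{i_m}|}\sum_{k_1\in B_{i_1},\ldots,k_m\in B_{i_m}}h(X_{k_1},\ldots,X_{k_m}).$$ Median: for $(a_1,\ldots,a_N)\in\mathbb{R}^N$,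 $\mathrm{Med}(a_1,\ldots,a_N)$ is any number $b$ with $|\{i\le N: a_i\le b\}|\ge N/2$ and $|\{i\le N:a_i\ge b\}|\ge N/2$. Robust estimator: $$\overline{U}_{\mathcal{B}}(h)=\mathrm{Med}\{U_{B_{i_1},\ldots,B_{i_m}}(h): 1\le i_1<\cdots<i_m\le V\}.$$ *)

(* Defs.v *)
From HB Require Import structures.
From mathcomp Require Import all_boot all_order all_algebra perm.
From mathcomp Require Import all_classical all_reals all_analysis.

Set Implicit Arguments.
Unset Strict Implicit.
Unset Printing Implicit Defensive.

Import Order.TTheory GRing.Theory Num.Theory.

Local Open Scope ring_scope.

(* An ordered partition (B_1, ..., B_V) of 'I_n; the blocks are nonempty. *)
Definition ordered_partition (n V : nat) (B : 'I_V -> {set 'I_n}) : Prop :=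
  injective B /\ finset.partition [set B K | K : 'I_V] [set: 'I_n].

Definition regular_partition (R : realType) (n V : nat) (B : 'I_V -> {set 'I_n}) :
    Prop :=
  ordered_partition B /\
  forall K : 'I_V, `| #|B K|%:R - n%:R / V%:R | <= 1 :> R.

Definition is_median (R : realType) (J : finType) (I : {set J}) (a : J -> R)
    (b : R) : Prop :=
  #|I|%:R / 2 <= #|[set i in I | a i <= b]|%:R :> R /\
  #|I|%:R / 2 <= #|[set i in I | a i >= b]|%:R :> R.

Section estimator.
Context (T : Type) (R : realType) (m n V : nat).
Variables (B : 'I_V -> {set 'I_n}) (h : m.-tuple T -> R).

(* U_{B_{i_1}, ..., B_{i_m}}(h) for the sample x. *)
Definition block_statistic (x : 'I_n -> T) (i : m.-tuple 'I_V) : R :=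
  (\prod_(j < m) #|B (tnth i j)|%:R)^-1 *
  \sum_(k : m.-tuple 'I_n | [forall j, tnth k j \in B (tnth i j)])
     h [tuple x (tnth k j) | j < m].

Definition increasing_indices : {set m.-tuple 'I_V} :=
  [set i : m.-tuple 'I_V | sorted ltn [seq val j | j <- i]].

(* The median is not unique: b is one of the possible values of the estimator. *)
Definition is_robust_estimate (x : 'I_n -> T) (b : R) : Prop :=
  is_median increasing_indices (block_statistic x) b.
End estimator.

Local Open Scope classical_set_scope.

(* A statement with an unspecified choice inside (such as a median) need not be
   about a measurable set, so "with probability at least r" is read as "on some
   event of probability at least r"; for measurable E this is r <= Pr E. *)
Definition with_probability_at_least (d : measure_display)
    (Omega : measurableType d) (R : realType) (Pr : probability Omega R)
    (r : R) (E : set Omega) : Prop :=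
  exists A : set Omega, [/\ measurable A, A `<=` E & (r%:E <= Pr A)%E].

(* X_1, ..., X_n are the variables X 0, ..., X n.-1; the rest of the sequence is
   unconstrained. *)
Definition iid_with_law (d d' : measure_display) (Omega : measurableType d)
    (T : measurableType d') (R : realType) (Pr : probability Omega R)
    (n : nat) (X : nat -> {RV Pr >-> T}) (P : probability T R) : Prop :=
  (forall (i : 'I_n) (A : set T), measurable A -> distribution Pr (X i) A = P A)
  /\
  (forall (J : {set 'I_n}) (A : 'I_n -> set T), (forall i, measurable (A i)) ->
     Pr (\bigcap_(i in [set` J]) (X i @^-1` A i)) =
     (\prod_(i in J) Pr (X i @^-1` A i))%E).

Section power_probability.
Context (d : measure_display) (T : measurableType d) (R : realType).

Definition tcons (k : nat) (z : T * k.-tuple T) : k.+1.-tuple T :=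
  [tuple of z.1 :: z.2].

Lemma measurable_tcons k : measurable_fun [set: T * k.-tuple T] (@tcons k).
Proof. exact: (measurable_cons measurable_fst measurable_snd). Qed.

HB.instance Definition _ k :=
  isMeasurableFun.Build _ _ _ _ (@tcons k) (@measurable_tcons k).

(* The product measure P^k on k-tuples. *)
Fixpoint power_probability (P : probability T R) (k : nat) :
    probability (k.-tuple T) R :=
  if k is k'.+1 return probability (k.-tuple T) R
  then distribution (P \x power_probability P k')%E (@tcons k')
  else \d_([tuple] : 0.-tuple T).
End power_probability.

Section kernels.
Context (d : measure_display) (T : measurableType d) (R : realType).
Implicit Types (P : probability T R) (m : nat).

Definition symmetric_kernel m (h : m.-tuple T -> R) : Prop :=
  forall (s : 'S_m) (x : m.-tuple T), h [tuple tnth x (s i) | i < m] = h x.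

(* The concatenation x ++ y as an m-tuple; it is only used for k + l = m, when
   the default value of nth is irrelevant. *)
Definition cat_as m k l (x : k.-tuple T) (y : l.-tuple T) : m.-tuple T :=
  [tuple nth point (x ++ y) i | i < m].

Definition kernel_mean P m (g : m.-tuple T -> R) : \bar R :=
  (\int[power_probability P m]_x (g x)%:E)%E.

(* The function (x_1, ..., x_k) |-> \int g(x_1, ..., x_m) dP^(m-k). *)
Definition kernel_section_mean P m (g : m.-tuple T -> R) k (x : k.-tuple T) :
    \bar R :=
  (\int[power_probability P (m - k)]_y (g (cat_as m x y))%:E)%E.

(* Degeneracy of order r. The integrals are extended reals, so for measurable g
   equality with a finite mean forces every section of g to be integrable. *)
Definition P_degenerate P m (g : m.-tuple T -> R) (r : nat) : Prop :=
  [/\ (0 < r < m)%N,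
      forall x : r.-tuple T, kernel_section_mean P g x = kernel_mean P g &
      ~ exists c : \bar R,
          forall x : r.+1.-tuple T, kernel_section_mean P g x = c].

Definition P_canonical P m (g : m.-tuple T -> R) : Prop :=
  kernel_mean P g = 0%E /\ P_degenerate P g m.-1.
End kernels.

(* Main.v *)
(** The median is farther than the bound t from the mean only if at least half of
   the increasing m-tuples of blocks are bad, that is, have a block statistic
   farther than t from the mean.

   One tuple is bad with probability at most 1/16: since h - m_h is canonical,
   adding one sample point to a block adds to the block sum a term whose integral
   over that point vanishes, and |x + y|^p <= |x|^p + l(x) y + 2 |y|^p then gives
   E |sum|^p <= (2 #|B_1| - 1) ... (2 #|B_m| - 1) M_p^p, whence Markov applies.

   The proportion of bad tuples is, by Hoeffding's decoupling, the average over
   the permutations of the blocks of averages of V/m independent votes, so its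
   exponential moment is at most that of a binomial proportion. *)

From HB Require Import structures.
Require Import Defs.
From mathcomp Require Import all_boot all_order all_algebra perm.
From mathcomp Require Import all_classical all_reals all_analysis.
From mathcomp Require Import measurable_realfun zify ring lra.

Set Implicit Arguments.
Unset Strict Implicit.
Unset Printing Implicit Defensive.

Import Order.TTheory GRing.Theory Num.Theory.

Local Open Scope classical_set_scope.
Local Open Scope ring_scope.

(** * The product law on tuples *)

(** The whole argument is moved to n-tuples with law P^n, where independence becomes Fubini's
    theorem: redrawing some coordinates from an independent copy preserves the law, and what does
    not depend on them is constant for the inner integral.

    Only moments of order p <= 2 are at hand, so the orthogonality behind a variance computation is
    replaced by an inequality whose cross term is linear in the increment. It handles one centered
    increment at a time, which is why sample points enter the blocks one by one.

    The constants fit together as follows. With l = ceil(log(1/delta)), the V = 32 m l blocks split,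
    for each permutation, into 32 l disjoint m-subsets, and a bad median forces at least 16 l bad
    votes on average over the permutations. Markov's inequality for 2^votes bounds this by
    ((17/16)^2 / 2)^(16 l) <= 4^(-l) <= e^(-l) <= delta. The failure probability 1/16 of a single
    tuple is what K_m is chosen to ensure. *)

Section product_law.
Context (d : measure_display) (T : measurableType d) (R : realType).
Variable P : probability T R.

Definition rectangle n (A : 'I_n -> set T) : set (n.-tuple T) :=
  [set x | forall i, A i (tnth x i)].

Lemma measurable_rectangle n (A : 'I_n -> set T) :
  (forall i, measurable (A i)) -> measurable (rectangle A).
Proof.
move=> mA.
have -> : rectangle A = \bigcap_i ((@tnth n T)^~ i @^-1` A i).
  by apply/seteqP; split => [x xA i _|x xA i]; exact: xA.
apply: fin_bigcap_measurable => [|i _]; first exact: finite_finset.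
by rewrite -[X in measurable X]setTI; exact: measurable_tnth.
Qed.

(** Preimages of single coordinates generate this sigma-algebra but are not closed under
    intersection; rectangles are, as the uniqueness of measures requires. *)
Lemma measurable_tuple_generated n :
  @measurable _ (n.-tuple T) =
  <<s [set rectangle A | A in [set A | forall i : 'I_n, measurable (A i)]] >>.
Proof.
apply/seteqP; split; last first.
  apply: smallest_sub; first exact: sigma_algebra_measurable.
  by move=> _ [A mA <-]; exact: measurable_rectangle.
apply: smallest_sub => [|B]; first exact: smallest_sigma_algebra.
rewrite -bigcup_seq => -[i _ [A mA <-{B}]]; rewrite setTI.
apply: sub_sigma_algebra.
exists (fun j => if j == i then A else setT) => [j /=|]; first by case: ifP.
apply/seteqP; split => [x /(_ i)|x xA j] /=; first by rewrite eqxx.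
by case: eqVneq => // ->.
Qed.

Lemma power_probability_rectangle n (A : 'I_n -> set T) :
  (forall i, measurable (A i)) ->
  power_probability P n (rectangle A) = (\prod_(i < n) P (A i))%E.
Proof.
elim: n A => [|n IHn] A mA.
  rewrite big_ord0 /= diracE mem_set//.
  by case.
rewrite big_ord_recl -IHn//= /distribution /pushforward.
rewrite -product_measure1E//; last exact: measurable_rectangle.
congr (_ _); apply/seteqP; split => -[x y] /=.
  move=> xyA; split; first exact: (xyA ord0).
  by move=> i; have := xyA (lift ord0 i); rewrite tnthS.
move=> [Ax Ay] i; case: (unliftP ord0 i) => [j|] ->.
  by rewrite tnthS; exact: Ay.
exact: Ax.
Qed.

Section characterization.
Context d' (Y : measurableType d') (nu : {measure set Y -> \bar R}).
Context n (phi : Y -> n.-tuple T).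
Hypothesis mphi : measurable_fun [set: Y] phi.
Hypothesis phi_rectangle : forall A : 'I_n -> set T,
  (forall i, measurable (A i)) ->
  nu (phi @^-1` rectangle A) = (\prod_(i < n) P (A i))%E.

Lemma power_probability_preimage E : measurable E ->
  nu (phi @^-1` E) = power_probability P n E.
Proof.
pose mphi_mixin := isMeasurableFun.Build _ _ _ _ _ mphi.
pose mphi_pack : {mfun _ >-> _} := HB.pack phi mphi_mixin.
move=> mE; rewrite -[LHS]/(pushforward nu mphi_pack E).
apply: (measure_unique
  [set rectangle A | A in [set A | forall i : 'I_n, measurable (A i)]]
  (fun=> setT)) => //.
- exact: measurable_tuple_generated.
- move=> _ _ [A mA <-] [B mB <-]; exists (fun i => A i `&` B i) => /=.
    by move=> i; exact: measurableI.
  apply/seteqP; split => [x xAB|x [xA xB] i]; last by split.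
  by split=> i; have [] := xAB i.
- move=> i; exists (fun=> setT) => //.
  by apply/seteqP; split.
- by rewrite bigcup_const.
- move=> _ [A mA <-].
  by apply: etrans (phi_rectangle mA) (esym (power_probability_rectangle mA)).
- move=> _; rewrite /= /pushforward preimage_setT.
  have := @phi_rectangle (fun=> setT) (fun=> measurableT).
  rewrite (_ : rectangle _ = setT); last by apply/seteqP; split.
  rewrite preimage_setT => ->.
  rewrite (eq_bigr (fun=> 1%E)) ?big1// ?ltry// => i _.
  exact: probability_setT.
Qed.

(** The positive and negative parts are transported separately, so the formula also covers sections
    of the kernel whose integrability is still to be derived. *)
Lemma integral_power_probability (f : n.-tuple T -> \bar R) :
  measurable_fun [set: n.-tuple T] f ->
  (\int[power_probability P n]_x f x = \int[nu]_y f (phi y))%E.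
Proof.
pose mphi_mixin := isMeasurableFun.Build _ _ _ _ _ mphi.
pose mphi_pack : {mfun _ >-> _} := HB.pack phi mphi_mixin.
move=> mf.
rewrite (eq_measure_integral (pushforward nu mphi_pack)); last first.
  by move=> A mA _; exact: esym (power_probability_preimage mA).
rewrite integralE [RHS]integralE; congr (_ - _)%E.
  rewrite (ge0_integral_pushforward mphi) ?preimage_setT//.
    by rewrite -funepos_comp.
  exact: measurable_funepos.
rewrite (ge0_integral_pushforward mphi) ?preimage_setT//.
  by rewrite -funeneg_comp.
exact: measurable_funeneg.
Qed.

End characterization.

Definition subtuple n l (k : 'I_l -> 'I_n) (x : n.-tuple T) : l.-tuple T :=
  [tuple tnth x (k j) | j < l].

Lemma tnth_subtuple n l (k : 'I_l -> 'I_n) x j :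
  tnth (subtuple k x) j = tnth x (k j).
Proof. exact: tnth_mktuple. Qed.

Lemma measurable_subtuple n l (k : 'I_l -> 'I_n) :
  measurable_fun setT (subtuple k).
Proof.
apply/measurable_fun_tnthP => j.
rewrite (_ : _ \o _ = (@tnth n T)^~ (k j)); first exact: measurable_tnth.
by apply/funext => x /=; rewrite tnth_mktuple.
Qed.

Lemma integral_subtuple n l (k : 'I_l -> 'I_n) (f : l.-tuple T -> \bar R) :
  injective k -> measurable_fun setT f ->
  (\int[power_probability P n]_x f (subtuple k x) =
   \int[power_probability P l]_x f x)%E.
Proof.
move=> kI mf; symmetry; apply: integral_power_probability => //.
  exact: measurable_subtuple.
move=> A mA.
(* Coordinate [k j] is constrained by [A j] and the coordinates outside the range of [k] are free,
   so the preimage is again a rectangle. *)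
pose B i := if [pick j | k j == i] is Some j then A j else setT.
have Bk j : B (k j) = A j.
  rewrite /B; case: pickP => [j' /eqP/kI -> //|/(_ j)].
  by rewrite eqxx.
have -> : subtuple k @^-1` rectangle A = rectangle B.
  apply/seteqP; split => x /= xA i.
    rewrite /B; case: pickP => // j /eqP <-.
    by have := xA j; rewrite tnth_mktuple.
  by rewrite tnth_mktuple -Bk.
have mB i : measurable (B i) by rewrite /B; case: pickP.
apply: etrans (power_probability_rectangle mB) _.
rewrite (bigID (fun i => i \in codom k)) /= [X in (_ * X)%E]big1 => [|i].
  rewrite mule1 -[RHS](eq_bigr _ (fun j _ => congr1 P (Bk j))).
  rewrite -big_uniq/=; last by rewrite map_inj_uniq ?enum_uniq.
  by rewrite big_map big_enum.
move=> ik; rewrite /B; case: pickP => [j /eqP kji|_].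
  by rewrite -kji codom_f in ik.
exact: probability_setT.
Qed.

Definition splice n (J : {set 'I_n}) (x y : n.-tuple T) : n.-tuple T :=
  [tuple if i \in J then tnth x i else tnth y i | i < n].

Lemma measurable_splice n (J : {set 'I_n}) :
  measurable_fun setT (fun z : n.-tuple T * n.-tuple T => splice J z.1 z.2).
Proof.
apply/measurable_fun_tnthP => j.
rewrite (_ : _ \o _ = if j \in J then (@tnth n T)^~ j \o fst
                                 else (@tnth n T)^~ j \o snd).
  by case: ifP => _; apply: measurableT_comp => //; exact: measurable_tnth.
by apply/funext => x /=; rewrite tnth_mktuple; case: ifP.
Qed.

(** Fubini for the coordinates in [J] against the others, phrased with two full tuples that each
    supply some coordinates, so that no tuple has to be cut in two. Independence of disjoint groups
    of coordinates is used in this form below. *)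
Lemma integral_splice n (J : {set 'I_n}) (f : n.-tuple T -> \bar R) :
  measurable_fun setT f -> (forall x, 0 <= f x)%E ->
  (\int[power_probability P n]_x f x =
   \int[power_probability P n]_x
      \int[power_probability P n]_y f (splice J x y))%E.
Proof.
move=> mf f0.
rewrite -(fubini_tonelli1 (fun z => f (splice J z.1 z.2)))//; last first.
  by apply: (measurableT_comp mf); exact: measurable_splice.
apply: integral_power_probability => //; first exact: measurable_splice.
move=> A mA.
pose B i := if i \in J then A i else setT.
pose C i := if i \in J then setT else A i.
have -> : (fun z => splice J z.1 z.2) @^-1` rectangle A =
    rectangle B `*` rectangle C.
  apply/seteqP; split => -[x y] /=.
    move=> xyA; split => i; have := xyA i; rewrite tnth_mktuple/= /B /C;
    by case: ifP.
  move=> [xB yC] i; have := xB i; have := yC i.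
  by rewrite tnth_mktuple/= /B /C; case: ifP.
have mB i : measurable (B i) by rewrite /B; case: ifP.
have mC i : measurable (C i) by rewrite /C; case: ifP.
apply: etrans (product_measure1E _ _ (measurable_rectangle mB)
  (measurable_rectangle mC)) _.
apply: etrans (congr2 mule (power_probability_rectangle mB)
  (power_probability_rectangle mC)) _.
rewrite -big_split/=; apply: eq_bigr => i _.
by rewrite /B /C; case: ifP; rewrite probability_setT ?mule1 ?mul1e.
Qed.

End product_law.

(** * Moments of block sums *)

Section powR_inequality.
Context (R : realType).
Implicit Types x y p : R.

Lemma powR_midpoint x y p : 1 <= p -> 0 <= x -> 0 <= y ->
  ((x + y) / 2) `^ p <= (x `^ p + y `^ p) / 2.
Proof.
move=> p1 x0 y0.
have half01 : 0 <= 2^-1 :> R /\ 2^-1 <= 1 :> R by split; lra.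
have := @convex_powR R p p1 (Itv01 half01.1 half01.2) x y.
rewrite !inE/= !in_itv/= !andbT => /(_ x0 y0).
rewrite -[X in X -> _]/(is_true ((2^-1 * x + (1 - 2^-1) * y) `^ p <=
  2^-1 * x `^ p + (1 - 2^-1) * y `^ p)).
have -> : 1 - 2^-1 = 2^-1 :> R by lra.
by rewrite -!mulrDr !(mulrC 2^-1).
Qed.

(** For 0 < u <= 1 one has u <= u^p; this is applied to the fractions x / (x + y) and y / (x + y),
    which sum to 1. *)
Lemma ger0_powRD x y p : 0 < p <= 1 -> 0 <= x -> 0 <= y ->
  (x + y) `^ p <= x `^ p + y `^ p.
Proof.
move=> /andP[p0 p1]; rewrite le0r => /predU1P[-> _|x0].
  by rewrite add0r powR0 ?gt_eqF// add0r.
rewrite le0r => /predU1P[->|y0].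
  by rewrite addr0 (powR0 (lt0r_neq0 p0)) addr0.
have xy0 : 0 < x + y by rewrite addr_gt0.
have fraction z : 0 < z <= x + y ->
    z / (x + y) * (x + y) `^ p <= z `^ p.
  move=> /andP[z0 zxy].
  rewrite -[in leRHS](divfK (lt0r_neq0 xy0) z) powRM; last 2 first.
  - by rewrite divr_ge0// ltW.
  - exact: ltW.
  rewrite ler_wpM2r ?powR_ge0// ger1_powR// divr_gt0//=.
  by rewrite ler_pdivrMr// mul1r.
have := lerD (fraction x _) (fraction y _).
rewrite -!mulrDl divff ?lt0r_neq0// mul1r.
by apply; apply/andP; split => //; lra.
Qed.

(* Clarkson's inequality *)
Lemma powR_parallelogram x y p : 1 < p <= 2 ->
  `|x + y| `^ p + `|x - y| `^ p <= 2 * (`|x| `^ p + `|y| `^ p).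
Proof.
move=> /andP[p1 p2]; have p0 : 0 < p by lra.
have pK z : 0 <= z -> (z `^ p) `^ (2 / p) = z ^+ 2.
  move=> z0; rewrite -powRrM (_ : p * (2 / p) = 2); last by field; lra.
  by rewrite powR_mulrn.
set u := `|x + y| `^ p; set v := `|x - y| `^ p.
have u0 : 0 <= u by exact: powR_ge0.
have v0 : 0 <= v by exact: powR_ge0.
have uv0 : 0 <= (u + v) / 2 by lra.
(* As 2 / p >= 1, the midpoint inequality for z^(2/p) turns u and v into squares, and the
   parallelogram identity gives ((u + v) / 2)^(2/p) <= |x|^2 + |y|^2. Subadditivity of z^(p/2) then
   separates x from y. *)
have : (u + v) / 2 <= ((`|x| ^+ 2 + `|y| ^+ 2)) `^ (p / 2).
  have -> : (u + v) / 2 = (((u + v) / 2) `^ (2 / p)) `^ (p / 2).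
    rewrite -powRrM (_ : 2 / p * (p / 2) = 1) ?powRr1//; field; lra.
  apply: ge0_ler_powR; rewrite ?nnegrE ?powR_ge0 ?addr_ge0 ?sqr_ge0//.
    by lra.
  apply: le_trans (powR_midpoint _ u0 v0) _; first by rewrite ler_pdivlMr; lra.
  by rewrite !pK// !real_normK ?num_real//; lra.
move=> /le_trans/(_ (ger0_powRD _ _ _)).
rewrite -!powR_mulrn// -!powRrM (_ : 2 * (p / 2) = p); last by field.
by move=> H; have := H _ (powR_ge0 _ _) (powR_ge0 _ _); lra.
Qed.

(** The tangent line of |.|^p at x, obtained without derivatives from Young's inequality for |x - y|
    and |x|^(p-1) with the conjugate exponents p and p / (p - 1). *)
Lemma powR_tangent x y p : 1 < p ->
  `|x| `^ p - p * `|x| `^ (p - 1) * Num.sg x * y <= `|x - y| `^ p.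
Proof.
move=> p1; have p0 : 0 < p by lra.
have q0 : 0 < p / (p - 1) by rewrite divr_gt0; lra.
have := @conjugate_powR R `|x - y| (`|x| `^ (p - 1)) p (p / (p - 1))
  (normr_ge0 _) (powR_ge0 _ _) p0 q0.
rewrite -powRrM (_ : (p - 1) * (p / (p - 1)) = p); last by field; lra.
have -> : p^-1 + (p / (p - 1))^-1 = 1 by field; lra.
move=> /(_ erefl) young.
have sg_le : Num.sg x * (x - y) <= `|x - y|.
  rewrite (le_trans (ler_norm _))// normrM ler_piMl//.
  by rewrite normr_sg; case: (x != 0).
have pE := mulr_powRB1 (normr_ge0 x) p0.
have sgx : Num.sg x * x = `|x| by rewrite [RHS]normrEsg.
have := ler_wpM2r (powR_ge0 `|x| (p - 1)) sg_le.
rewrite mulrBr sgx mulrBl pE => /le_trans/(_ young).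
set w := `|x - y| `^ p; set a := `|x| `^ p; set b := `|x| `^ (p - 1).
move=> /(ler_wpM2l (ltW p0)).
have -> : p * (w / p + a / (p / (p - 1))) = w + a * (p - 1) by field; lra.
by lra.
Qed.

(** Clarkson's inequality minus the tangent bound on |x - y|^p. The factor 2 is the price paid
    compared with the expansion of a square. *)
Lemma powRD_le_linear x y p : 1 < p <= 2 ->
  `|x + y| `^ p <=
  `|x| `^ p + p * `|x| `^ (p - 1) * Num.sg x * y + 2 * `|y| `^ p.
Proof.
move=> p12; have := powR_parallelogram x y p12.
by have /andP[/(powR_tangent x y)] := p12; lra.
Qed.

End powR_inequality.

Section centered_moment.
Context d (Y : measurableType d) (R : realType) (mu : probability Y R).
Variable (p : R).
Hypothesis p12 : 1 < p <= 2.
Local Open Scope ereal_scope.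

(* The positive and negative parts cannot both be infinite: oo - oo is -oo. *)
Lemma integral_eq0_integrable (f : Y -> R) : measurable_fun setT f ->
  \int[mu]_y (f y)%:E = 0 -> mu.-integrable setT (EFin \o f).
Proof.
move=> mf; have mEf : measurable_fun setT (EFin \o f) by exact/measurable_EFinP.
rewrite integralE => f0; apply/integrableP; split => //.
rewrite -[X in integral _ _ X]/(abse \o (EFin \o f)) fune_abse.
rewrite ge0_integralD//; last 2 first.
- exact: measurable_funepos.
- exact: measurable_funeneg.
have pos0 : 0 <= \int[mu]_y (EFin \o f)^\+ y by exact: integral_ge0.
have neg0 : 0 <= \int[mu]_y (EFin \o f)^\- y by exact: integral_ge0.
move: f0 pos0 neg0.
by case: integral => [a||]; case: integral => [b||]//; rewrite ltry.
Qed.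

Lemma integral_powRD_centered (f : Y -> R) (a : R) : measurable_fun setT f ->
  \int[mu]_y (f y)%:E = 0 ->
  \int[mu]_y (`|a + f y| `^ p)%:E <=
  (`|a| `^ p)%:E + 2%:E * \int[mu]_y (`|f y| `^ p)%:E.
Proof.
move=> mf f0; have intf := integral_eq0_integrable mf f0.
have mpow (g : Y -> R) : measurable_fun setT g ->
    measurable_fun setT (fun y => `|g y| `^ p)%R.
  move=> mg; apply: (measurableT_comp (measurable_powR p)).
  exact: measurableT_comp.
have mfp := mpow _ mf.
have mafp : measurable_fun setT (fun y => `|a + f y| `^ p)%R.
  by apply: mpow; exact: measurable_funD.
(* If the p-th moment of f is infinite, so is the right-hand side. Otherwise every term of the
   pointwise bound is integrable and can be integrated separately. *)
have [|finf] := leP +oo (\int[mu]_y (`|f y| `^ p)%:E).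
  by rewrite leye_eq => /eqP ->; rewrite gt0_muley// addey// leey.
have intfp : mu.-integrable setT (EFin \o (fun y => `|f y| `^ p)%R).
  apply/integrableP; split; first exact/measurable_EFinP.
  under eq_integral do rewrite /= ger0_norm ?powR_ge0//.
  exact: finf.
pose c := (p * `|a| `^ (p - 1) * Num.sg a)%R.
have bound y : (`|a + f y| `^ p <= `|a| `^ p + c * f y + 2 * `|f y| `^ p)%R.
  exact: powRD_le_linear.
have intcf : mu.-integrable setT (fun y => (c * f y)%:E).
  by under eq_fun do rewrite EFinM; exact: integrableZl.
have int2fp : mu.-integrable setT (fun y => (2 * `|f y| `^ p)%:E).
  by under eq_fun do rewrite EFinM; exact: integrableZl.
have intcst : mu.-integrable setT (fun=> (`|a| `^ p)%:E).
  exact: finite_measure_integrable_cst.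
have int12 : mu.-integrable setT (fun y => (`|a| `^ p)%:E + (c * f y)%:E).
  exact: integrableD.
apply: (@le_trans _ _ (\int[mu]_y ((`|a| `^ p)%:E + (c * f y)%:E +
    (2 * `|f y| `^ p)%:E))).
  apply: le_integral => //.
  - apply: le_integrable (integrableD _ int12 int2fp) => //.
      exact/measurable_EFinP.
    move=> y _; rewrite -!EFinD lee_fin ger0_norm ?powR_ge0//.
    exact: le_trans (bound y) (ler_norm _).
  - exact: integrableD.
  - by move=> y _; rewrite -!EFinD lee_fin.
rewrite integralD// integralD// integral_cst//.
rewrite [X in _ * X + _](probability_setT mu) mule1.
under eq_integral do rewrite EFinM.
under [X in _ + X <= _]eq_integral do rewrite EFinM.
by rewrite !integralZl// f0 mule0 adde0.
Qed.

End centered_moment.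

Section block_sums.
Context (d : measure_display) (T : measurableType d) (R : realType).
Variables (P : probability T R) (p : R) (n m : nat).
Hypothesis p12 : 1 < p <= 2.
Local Notation Pn := (power_probability P n).

(** Only coordinate [c] of [y] is used, so integrating over [y] integrates over one sample point
    with the others frozen. *)
Definition resample (c : 'I_n) (x y : n.-tuple T) : n.-tuple T :=
  splice (~: [set c])%SET x y.

Lemma tnth_resample c x y i :
  tnth (resample c x y) i = if i == c then tnth y i else tnth x i.
Proof. by rewrite tnth_mktuple finset.in_setC finset.in_set1; case: eqVneq. Qed.

Lemma measurable_resample c :
  measurable_fun setT (fun z => resample c z.1 z.2).
Proof. exact: measurable_splice. Qed.

Lemma integral_resample c (f : n.-tuple T -> \bar R) :
  measurable_fun setT f -> (forall x, 0 <= f x)%E ->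
  (\int[Pn]_x f x = \int[Pn]_x \int[Pn]_y f (resample c x y))%E.
Proof. exact: integral_splice. Qed.

(** For fixed x, the inner integral over coordinate [c] sees f as a constant and g as a centered
    variable, so the one-variable inequality applies before the integration over x. *)
Lemma integral_powRD_coordinate (c : 'I_n) (f g : n.-tuple T -> R) :
  measurable_fun setT f -> measurable_fun setT g ->
  (forall x y, f (resample c x y) = f x) ->
  (forall x, \int[Pn]_y (g (resample c x y))%:E = 0)%E ->
  (\int[Pn]_x (`|f x + g x| `^ p)%:E <=
   \int[Pn]_x (`|f x| `^ p)%:E + 2%:E * \int[Pn]_x (`|g x| `^ p)%:E)%E.
Proof.
move=> mf mg f_c g0.
have mpow (u : n.-tuple T -> R) : measurable_fun setT u ->
    measurable_fun setT (fun x => (`|u x| `^ p)%:E).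
  move=> mu; apply/measurable_EFinP.
  apply: (measurableT_comp (measurable_powR p)).
  exact: measurableT_comp.
have mfg : measurable_fun setT (fun x => f x + g x) by exact: measurable_funD.
have mgp : measurable_fun setT (fun x =>
    \int[Pn]_y (`|g (resample c x y)| `^ p)%:E)%E.
  apply: (measurable_fun_fubini_tonelli_F
    (fun z => (`|g (resample c z.1 z.2)| `^ p)%:E)) => //.
  exact: (measurableT_comp (mpow g mg) (measurable_resample c)).
rewrite (integral_resample c (mpow _ mfg))//.
rewrite [X in (_ <= _ + _ * X)%E](integral_resample c (mpow _ mg))//.
have int0 x : (0 <= \int[Pn]_y (`|g (resample c x y)| `^ p)%:E)%E.
  by apply: integral_ge0 => y _; rewrite lee_fin powR_ge0.
apply: (@le_trans _ _ (\int[Pn]_x ((`|f x| `^ p)%:E +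
    2%:E * \int[Pn]_y (`|g (resample c x y)| `^ p)%:E))%E); last first.
  rewrite (ge0_integralD _ _ _ (mpow _ mf)) ?(ge0_integralZl _ _ mgp)//.
  - by move=> x _; rewrite mule_ge0.
  - exact: measurable_funeM.
apply: ge0_le_integral; first exact: measurableT.
- by move=> x _; apply: integral_ge0 => y _; rewrite lee_fin powR_ge0.
- apply: (measurable_fun_fubini_tonelli_F
    (fun z => (`|f (resample c z.1 z.2) + g (resample c z.1 z.2)|
       `^ p)%:E)) => //.
  exact: (measurableT_comp (mpow _ mfg) (measurable_resample c)).
- by apply: emeasurable_funD; [exact: mpow|exact: measurable_funeM].
- move=> x _; under eq_integral do rewrite f_c.
  apply: integral_powRD_centered => //.
  apply: (measurableT_comp mg).
  exact: (measurableT_comp (measurable_resample c) (measurable_pair1 x)).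
Qed.

Variable g : m.-tuple T -> R.
Hypothesis g_sym : symmetric_kernel g.
Hypothesis mg : measurable_fun setT g.
Hypothesis m_gt0 : (0 < m)%N.
Hypothesis g_section : forall x : (m.-1).-tuple T, kernel_section_mean P g x = 0%E.

(* Degeneracy only speaks of the last argument of g; symmetry moves j there. *)
Lemma integral_section_eq0 (k : 'I_m -> 'I_n) (j : 'I_m) (x : n.-tuple T) :
  (forall i, (k i == k j) = (i == j)) ->
  (\int[Pn]_y (g (subtuple k (resample (k j) x y)))%:E = 0)%E.
Proof.
move=> kj.
have m1 : (m.-1 < m)%N by rewrite ltn_predL.
have mS : (m - m.-1 = 1)%N by rewrite -[in LHS](prednK m_gt0) subSnn.
pose last : 'I_m := Ordinal m1.
pose s := tperm j last.
pose x' : (m.-1).-tuple T :=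
  [tuple tnth x (k (s (widen_ord (leq_pred m) i))) | i < m.-1].
(* The length [m - m.-1] equals 1 only through the equation [mS]; the constant index map fills the
   single entry with coordinate [k j]. *)
pose y' (y : n.-tuple T) : (m - m.-1).-tuple T := subtuple (fun=> k j) y.
have cat_lt (y : n.-tuple T) (i : 'I_m) : (i < m.-1)%N ->
    tnth (cat_as m x' (y' y)) i = tnth x (k (s i)).
  move=> im; rewrite tnth_mktuple nth_cat size_tuple im.
  rewrite -[i : nat]/(nat_of_ord (Ordinal im)) -tnth_nth tnth_mktuple.
  by congr (tnth x (k (s _))); exact: val_inj.
have cat_last (y : (m - m.-1).-tuple T) :
    tnth (cat_as m x' y) last = nth point y 0.
  by rewrite tnth_mktuple nth_cat size_tuple ltnn subnn.
have gE y : g (subtuple k (resample (k j) x y)) = g (cat_as m x' (y' y)).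
  rewrite -(g_sym s); congr g; apply: eq_from_tnth => i.
  rewrite tnth_mktuple tnth_subtuple tnth_resample kj.
  have [im|] := ltnP i m.-1.
    rewrite cat_lt// ifF//; apply/negbTE.
    rewrite (canF_eq (tpermK _ _)) tpermL.
    by apply: contraTneq im => ->; rewrite /= ltnn.
  move=> mi; have -> : i = last.
    by apply/val_inj/eqP; rewrite eqn_leq mi -ltnS prednK// ltn_ord.
  rewrite tpermR eqxx cat_last.
  have lt0 : (0 < m - m.-1)%N by rewrite mS.
  by rewrite -[0%N]/(nat_of_ord (Ordinal lt0)) -tnth_nth tnth_mktuple.
under eq_integral do rewrite gE.
rewrite (@integral_subtuple _ _ _ P n _ (fun=> k j)
  (fun y => (g (cat_as m x' y))%:E)).
- exact: g_section.
- move=> a b _; apply: val_inj.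
  have val0 (i : 'I_(m - m.-1)) : val i = 0%N.
    by apply/eqP; rewrite -leqn0 -ltnS -[X in (_ < X)%N]mS ltn_ord.
  by rewrite !val0.
- apply/measurable_EFinP; apply: (measurableT_comp mg).
  apply/measurable_fun_tnthP => i.
  have [im|mi] := ltnP i m.-1.
    rewrite (_ : _ \o _ = cst (tnth x' (Ordinal im))); first exact: measurable_cst.
    apply/funext => y /=; rewrite tnth_mktuple nth_cat size_tuple im.
    by rewrite -[i : nat]/(nat_of_ord (Ordinal im)) -tnth_nth.
  have im : (i - m.-1 < m - m.-1)%N.
    by rewrite ltn_sub2r.
  rewrite (_ : _ \o _ = (@tnth _ T)^~ (Ordinal im)); first exact: measurable_tnth.
  apply/funext => y /=; rewrite tnth_mktuple nth_cat size_tuple ltnNge mi/=.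
  by rewrite -[(i - m.-1)%N]/(nat_of_ord (Ordinal im)) -tnth_nth.
Qed.

(** The sets are arbitrary, not blocks of the partition, because the moment bound is proved by
    shrinking one of them point by point. *)
Definition block_sum (C : 'I_m -> {set 'I_n}) (x : n.-tuple T) : R :=
  \sum_(k : m.-tuple 'I_n | [forall j, tnth k j \in C j]) g (subtuple (tnth k) x).

Lemma measurable_kernel_subtuple (k : 'I_m -> 'I_n) :
  measurable_fun setT (fun x => g (subtuple k x)).
Proof. by apply: (measurableT_comp mg); exact: measurable_subtuple. Qed.

Lemma measurable_block_sum C : measurable_fun setT (block_sum C).
Proof.
pose t (k : m.-tuple 'I_n) x :=
  if [forall j, tnth k j \in C j] then g (subtuple (tnth k) x) else 0.
have -> : block_sum C = (fun x => \sum_k t k x).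
  by apply/funext => x; rewrite /block_sum big_mkcond.
apply: measurable_sum => k; rewrite /t.
case: [forall j, tnth k j \in C j]; last exact: measurable_cst.
exact: measurable_kernel_subtuple.
Qed.

Lemma block_sum_eq (C : 'I_m -> {set 'I_n}) x y :
  (forall j c, c \in C j -> tnth x c = tnth y c) ->
  block_sum C x = block_sum C y.
Proof.
move=> xy; apply: eq_bigr => k /forallP kC; congr g.
by apply: eq_from_tnth => j; rewrite !tnth_mktuple; exact: xy (kC j).
Qed.

Lemma block_sumD1 (C : 'I_m -> {set 'I_n}) j c x : c \in C j ->
  block_sum C x =
  block_sum (fun i => if i == j then (C j :\ c)%SET else C i) x +
  block_sum (fun i => if i == j then [set c]%SET else C i) x.
Proof.
move=> cC; rewrite [LHS](bigID (fun k => tnth k j == c))/= addrC; congr (_ + _).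
  apply: eq_bigl => k; apply/andP/forallP => [[/forallP kC kj] i|kC].
    by case: eqVneq => // ->; rewrite finset.in_setD1 kj kC.
  have := kC j; rewrite eqxx finset.in_setD1 => /andP[-> _]; split => //.
  apply/forallP => i; have := kC i; case: eqVneq => // ->.
  by rewrite finset.in_setD1 => /andP[].
apply: eq_bigl => k; apply/andP/forallP => [[/forallP kC kj] i|kC].
  by case: eqVneq => // ->; rewrite finset.in_set1 kj.
have := kC j; rewrite eqxx finset.in_set1 => kj; split => //.
apply/forallP => i; have := kC i; case: eqVneq => // ->.
by rewrite (eqP kj).
Qed.

Lemma integral_block_sum_eq0 (C : 'I_m -> {set 'I_n}) j c x :
  C j = [set c]%SET -> (forall i, i != j -> c \notin C i) ->
  (\int[Pn]_y (block_sum C (resample c x y))%:E = 0)%E.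
Proof.
move=> Cj cC.
pose t (k : m.-tuple 'I_n) y : \bar R :=
  if [forall i, tnth k i \in C i]
  then (g (subtuple (tnth k) (resample c x y)))%:E else 0%E.
have t0 k : (\int[Pn]_y t k y = 0)%E /\ Pn.-integrable setT (t k).
  rewrite /t; case: (boolP [forall i, _]) => [/forallP kC|_]; last first.
    by rewrite integral0; split => //; exact: integrable0.
  have kj : tnth k j = c by have := kC j; rewrite Cj finset.in_set1 => /eqP.
  have k0 : (\int[Pn]_y (g (subtuple (tnth k) (resample c x y)))%:E = 0)%E.
    rewrite -{1}kj; apply: integral_section_eq0 => i.
    rewrite kj; have [->|ij] := eqVneq i j; first by rewrite kj eqxx.
    by apply: contraNF (cC i ij) => /eqP <-.
  (* A zero integral already implies integrability, which allows the finite sum to be exchanged with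
     the integral below. *)
  split => //; apply: integral_eq0_integrable k0.
  apply: (measurableT_comp (measurable_kernel_subtuple _)).
  exact: (measurableT_comp (measurable_resample c) (measurable_pair1 x)).
transitivity (\int[Pn]_y \sum_k t k y)%E.
  apply: eq_integral => y _; rewrite -sumEFin [LHS]big_mkcond.
  by apply: eq_bigr => k _.
rewrite integral_sum//; last by move=> k; exact: (t0 k).2.
by rewrite big1// => k _; exact: (t0 k).1.
Qed.

(* The factor b(s) = 2 s - 1 solves b(1) = 1, b(s) = b(s - 1) + 2 b(1), and the
   truncated subtraction gives the right value b(0) = 0 for an empty block. *)
Lemma integral_block_sum_powR (C : 'I_m -> {set 'I_n}) (M : R) :
  (forall i j c, i != j -> c \in C i -> c \notin C j) ->
  (\int[power_probability P m]_x (`|g x| `^ p)%:E <= M%:E)%E ->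
  (\int[Pn]_x (`|block_sum C x| `^ p)%:E <=
   ((\prod_j (2 * #|C j| - 1)%N)%:R * M)%:E)%E.
Proof.
move=> + gM.
have M0 : 0 <= M.
  rewrite -lee_fin; apply: le_trans gM.
  by apply: integral_ge0 => x _; rewrite lee_fin powR_ge0.
have p0 : p != 0 by case/andP: p12 => p1 _; apply/eqP; lra.
(* The induction is on the total number of points in the sets. When [C j] has at least two points,
   both [C j] without c and the singleton of c are strictly smaller. *)
have [N] := ubnP (\sum_j #|C j|)%N; elim: N C => // N IHN C CN dC.
(* Base case, no set with two points: an empty set makes the sum empty; otherwise the disjoint
   singletons leave one term with distinct sample points, whose moment is that of g. *)
have [/existsP[j Cj]|/existsPn C1] := boolP [exists j, 1 < #|C j|]%N; last first.
  have [/existsP[j /eqP Cj]|/existsPn C0] := boolP [exists j, C j == finset.set0].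
    rewrite (eq_integral (fun=> 0%E)) => [|x _].
      by rewrite integral0 lee_fin mulr_ge0.
    rewrite /block_sum big_pred0 ?normr0 ?powR0// => k.
    by apply/negbTE/forallPn; exists j; rewrite Cj finset.in_set0.
  have CE j : exists c, C j == [set c]%SET.
    have /cards1P[c ->] : #|C j| == 1%N; last by exists c.
    have := C1 j; have := C0 j; rewrite -cards_eq0.
    by case: #|C j| => [|[|]].
  pose k j := xchoose (CE j).
  have Ck j : C j = [set k j]%SET by apply/eqP; exact: xchooseP (CE j).
  have kI : injective k.
    move=> i j kij; apply/eqP/contraT => /(dC _ _ (k i)).
    by rewrite !Ck kij !finset.in_set1 eqxx => /(_ isT).
  rewrite big1 => [|j _]; last by rewrite Ck cards1.
  rewrite mul1r; apply: le_trans gM.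
  rewrite -(@integral_subtuple _ _ _ P _ _ k (fun x => (`|g x| `^ p)%:E) kI);
    last first.
    apply/measurable_EFinP; apply: (measurableT_comp (measurable_powR p)).
    exact: measurableT_comp.
  rewrite le_eqVlt; apply/orP; left; apply/eqP.
  apply: eq_integral => x _; rewrite /block_sum.
  rewrite (big_pred1 [tuple k j | j < m]) => [|i].
    by congr ((`|g _| `^ p)%:E); apply: eq_from_tnth => j; rewrite !tnth_mktuple.
  apply/forallP/eqP => [iC|-> j].
    by apply: eq_from_tnth => j; have := iC j;
       rewrite Ck finset.in_set1 tnth_mktuple => /eqP.
  by rewrite tnth_mktuple Ck finset.in_set1.
have [c cC] : exists c, c \in C j.
  by apply/card_gt0P; exact: ltnW.
have cCi i : i != j -> c \notin C i.
  by rewrite eq_sym => /dC; exact.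
pose C1 i := if i == j then (C j :\ c)%SET else C i.
pose C2 i := if i == j then [set c]%SET else C i.
have C1C i : C1 i \subset C i.
  by rewrite /C1; case: eqVneq => // ->; exact: finset.subD1set.
have C2C i : C2 i \subset C i.
  by rewrite /C2; case: eqVneq => // ->; rewrite finset.sub1set.
have cardC1 : #|C1 j| = #|C j|.-1.
  by rewrite /C1 eqxx [in RHS](finset.cardsD1 c) cC.
have cardC2 : #|C2 j| = 1%N by rewrite /C2 eqxx cards1.
have sum_lt (C' : 'I_m -> {set 'I_n}) : (forall i, C' i \subset C i) ->
    (#|C' j| < #|C j|)%N -> (\sum_i #|C' i| < N)%N.
  move=> C'C C'j; apply: leq_trans (CN : (_ <= N)%N).
  rewrite (bigD1 j)//= [ltnRHS](bigD1 j)//= -addSn leq_add//.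
  by apply: leq_sum => i _; exact: subset_leq_card.
have disj (C' : 'I_m -> {set 'I_n}) : (forall i, C' i \subset C i) ->
    forall i i' e, i != i' -> e \in C' i -> e \notin C' i'.
  move=> C'C i i' e /(dC _ _ e) ii' /(fintype.subsetP (C'C i))/ii'.
  by apply: contra => /(fintype.subsetP (C'C i')).
have IH1 := IHN C1 (sum_lt _ C1C _) (disj _ C1C).
have IH2 := IHN C2 (sum_lt _ C2C _) (disj _ C2C).
have split_le := integral_powRD_coordinate (c := c) (measurable_block_sum C1)
  (measurable_block_sum C2).
under eq_integral do rewrite (block_sumD1 _ cC).
apply: le_trans (split_le _ _) _.
- move=> x y; apply: block_sum_eq => i e eC1; rewrite tnth_resample ifF//.
  apply: contraTF eC1 => /eqP ->; rewrite /C1.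
  by case: eqVneq => [_|/cCi//]; rewrite finset.in_setD1 eqxx.
- move=> x; apply: (@integral_block_sum_eq0 _ j); first by rewrite /C2 eqxx.
  by move=> i ij; rewrite /C2 (negbTE ij) cCi.
apply: le_trans (leeD (IH1 _) (lee_wpmul2l _ (IH2 _))) _ => //.
- by rewrite cardC1 prednK// ltnW.
- by rewrite cardC2.
rewrite -EFinM -EFinD lee_fin mulrA -mulrDl ler_wpM2r// -natrM -natrD ler_nat.
rewrite (bigD1 j)//= [X in (_ + 2 * X)%N](bigD1 j)//= [leqRHS](bigD1 j)//=.
rewrite cardC1 cardC2 (eq_bigr (fun i => (2 * #|C i| - 1)%N)); last first.
  by move=> i /negbTE ij; rewrite /C1 ij.
rewrite [X in (_ + 2 * (_ * X))%N](eq_bigr (fun i => (2 * #|C i| - 1)%N)); last first.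
  by move=> i /negbTE ij; rewrite /C2 ij.
rewrite mul1n -mulnDl leq_mul2r; apply/orP; right.
by move: Cj; case: #|C j| => [|[|a]]//= _; clear; lia.
Qed.

End block_sums.

(** * Votes of the m-subsets of blocks *)

Section permutation_average.
Local Open Scope nat_scope.
Variable V : finType.
Implicit Types A S : {set V}.

Lemma card_permT : #|{perm V}| = (#|V|)`!.
Proof.
rewrite -[in RHS]cardsT -card_perm; apply: eq_card => s.
by rewrite inE; apply/esym/fintype.subsetP => x; rewrite !inE.
Qed.

Lemma perm_imset_transitive A S : #|A| = #|S| ->
  exists t : {perm V}, (t @: A = S)%SET.
Proof.
move=> AS.
(* Listing a set before its complement enumerates all of V; matching the two lists position by
   position carries A onto S. *)
pose list S := enum S ++ enum (~: S)%SET.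
have list_mem S' x : x \in list S'.
  by rewrite mem_cat !mem_enum finset.in_setC orbN.
have list_uniq S' : uniq (list S').
  rewrite cat_uniq !enum_uniq/= andbT; apply/hasPn => x.
  by rewrite !mem_enum finset.in_setC.
have list_size S' : size (list S') = #|V|.
  by rewrite size_cat -!cardE cardsC.
pose f x := nth x (list S) (index x (list A)).
have f_inj : injective f.
  move=> x y; rewrite /f (set_nth_default y); last first.
    by rewrite list_size -(list_size A) index_mem.
  move/eqP; rewrite nth_uniq ?list_size -?(list_size A) ?index_mem// => /eqP.
  by move/(congr1 (nth x (list A))); rewrite !nth_index.
exists (perm f_inj); apply/eqP; rewrite eqEcard card_imset ?AS ?leqnn ?andbT//.
  apply/fintype.subsetP => _ /imsetP[x xA ->]; rewrite permE /f.
  have xi : index x (enum A) < size (enum S).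
    by rewrite -cardE -AS cardE index_mem mem_enum.
  rewrite {2}/list index_cat mem_enum xA nth_cat xi -mem_enum.
  exact: mem_nth.
exact: perm_inj.
Qed.

(** The image of A under a uniform permutation is uniform among the sets of its size: by
    transitivity the number [W S] of permutations carrying A to S is the same for all such S. Taking
    f = 1 evaluates this number, which is then eliminated. *)
Lemma sum_perm_imset A (f : {set V} -> nat) :
  (\sum_(s : {perm V}) f (s @: A)%SET) * #|[set S : {set V} | #|S| == #|A|]%SET| =
  (#|V|)`! * \sum_(S : {set V} | #|S| == #|A|) f S.
Proof.
pose W S := \sum_(s : {perm V}) ((s @: A)%SET == S).
have WA S : #|S| = #|A| -> W S = W A.
  move=> /perm_imset_transitive[t tSA].
  rewrite [RHS](reindex_inj (mulIg t)); apply: eq_bigr => s _.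
  have -> : ((s * t)%g @: A = t @: (s @: A))%SET.
    by rewrite -imset_comp; apply: eq_imset => x /=; rewrite permM.
  by rewrite -tSA (inj_eq (imset_inj (@perm_inj _ t))).
have sumW (g : {set V} -> nat) :
    \sum_(s : {perm V}) g (s @: A)%SET =
    W A * \sum_(S : {set V} | #|S| == #|A|) g S.
  rewrite big_distrr/=.
  under [RHS]eq_bigr => S /eqP SA do rewrite -(WA S SA) /W big_distrl/=.
  rewrite exchange_big/=; apply: eq_bigr => s _.
  rewrite (bigD1 (s @: A)%SET)/=; last by rewrite card_imset//; exact: perm_inj.
  rewrite eqxx mul1n big1 ?addn0// => S /andP[_].
  by rewrite eq_sym => /negbTE ->.
have := sumW (fun=> 1); rewrite sum1_card sum1dep_card card_permT.
by move=> ->; rewrite (sumW f) mulnAC.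
Qed.

End permutation_average.

Section majority_vote.
Context (d : measure_display) (T : measurableType d) (R : realType).
Variables (P : probability T R) (n : nat).
Local Notation Pn := (power_probability P n).

Definition depends_on (D : {set 'I_n}) (rT : Type) (f : n.-tuple T -> rT) :=
  forall x y, (forall c, c \in D -> tnth x c = tnth y c) -> f x = f y.

(** Splicing along [D j] makes the factor j a function of x alone and the remaining product a
    function of y alone, so the double integral factors. *)
Lemma integral_prod_independent (J : eqType) (s : seq J)
    (D : J -> {set 'I_n}) (f : J -> n.-tuple T -> R) :
  uniq s -> (forall i j c, i != j -> c \in D i -> c \notin D j) ->
  (forall j, measurable_fun setT (f j)) -> (forall j x, 0 <= f j x) ->
  (forall j, depends_on (D j) (f j)) ->
  (\int[Pn]_x (\prod_(j <- s) f j x)%:E =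
   \prod_(j <- s) \int[Pn]_x (f j x)%:E)%E.
Proof.
move=> + dD mf f0 fD; elim: s => [_|j s IHs /andP[js us]].
  under eq_integral do rewrite big_nil.
  by rewrite big_nil integral_cst// mul1e; exact: probability_setT.
have prod_ge0 x : 0 <= \prod_(i <- s) f i x by exact: prodr_ge0.
have mprod (s' : seq J) : measurable_fun setT (fun x => \prod_(i <- s') f i x).
  exact: measurable_prod.
rewrite big_cons -IHs//; under eq_integral do rewrite big_cons.
rewrite [LHS](@integral_splice _ _ _ _ _ (D j)); last 2 first.
- by apply/measurable_EFinP; exact: measurable_funM (mf j) (mprod s).
- by move=> x; rewrite lee_fin mulr_ge0.
have splice_j x y : f j (splice (D j) x y) = f j x.
  by apply: fD => c cD; rewrite tnth_mktuple cD.
have splice_s x y : \prod_(i <- s) f i (splice (D j) x y) = \prod_(i <- s) f i y.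
  apply: eq_big_seq => i si; apply: fD => c cD; rewrite tnth_mktuple ifF//.
  by apply/negbTE; apply: dD cD; apply: contraNneq js => <-.
transitivity (\int[Pn]_x ((f j x)%:E * \int[Pn]_y (\prod_(i <- s) f i y)%:E))%E.
  apply: eq_integral => x _; under eq_integral do rewrite splice_j splice_s EFinM.
  rewrite ge0_integralZl_EFin//; last exact/measurable_EFinP.
  by move=> y _; rewrite lee_fin.
rewrite ge0_integralZr//; first exact/measurable_EFinP.
  by move=> x _; rewrite lee_fin.
by apply: integral_ge0 => y _; rewrite lee_fin.
Qed.

Variables (V m r : nat) (B : 'I_V -> {set 'I_n}).
Hypothesis V_blocks : V = (r * 2 * m)%N.
Hypothesis disjointB : forall K L c, K != L -> c \in B K -> c \notin B L.
Variables (bad : {set 'I_V} -> n.-tuple T -> bool) (q : R).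
Hypothesis mbad : forall S, measurable_fun setT (bad S).
Hypothesis badB : forall S : {set 'I_V},
  depends_on (\bigcup_(K in S) B K)%SET (bad S).
Hypothesis q0 : 0 <= q.
Hypothesis bad_le : forall S : {set 'I_V}, #|S| = m ->
  (Pn [set x | bad S x] <= q%:E)%E.

(** The secant of 2^t through a and a + 1 lies below 2^t at every integer. Being linear in b, it
    does the work of Jensen's inequality for the average over permutations. *)
Lemma expr2_ge_linear (a b : nat) : 2 ^+ a * (1 + b%:R - a%:R) <= 2 ^+ b :> R.
Proof.
have [ab|ba] := leqP a b.
  rewrite -(subnKC ab) exprD ler_pM2l ?exprn_gt0// natrD.
  have : (b - a)%:R + 1 <= 2 ^+ (b - a) :> R.
    by rewrite natr1 -natrX ler_nat; exact: ltn_expl.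
  by lra.
apply: (@le_trans _ _ 0); last exact: exprn_ge0.
rewrite mulr_ge0_le0 ?exprn_ge0//.
have : b%:R + 1 <= a%:R :> R by rewrite natr1 ler_nat.
by lra.
Qed.

Lemma measurable_bad S : measurable_fun setT (fun x => (bad S x)%:R : R).
Proof.
rewrite (_ : (fun x => _) = fun x => if bad S x then 1 else 0 : R).
  exact: measurable_fun_ifT.
by apply/funext => x; case: bad.
Qed.

Lemma measurable_majority : measurable
  [set x | (#|[set S : {set 'I_V} | #|S| == m]%SET| <=
            2 * \sum_(S : {set 'I_V} | #|S| == m) bad S x)%N].
Proof.
pose votes (x : n.-tuple T) : R :=
  \sum_(S : {set 'I_V}) (#|S| == m)%:R * (bad S x)%:R.
have mvotes : measurable_fun setT votes.
  by apply: measurable_sum => S; apply: measurable_funM => //; exact: measurable_bad.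
rewrite (_ : [set x | _] = setT `&` (fun x => 2 * votes x) @^-1`
    `[#|[set S : {set 'I_V} | #|S| == m]%SET|%:R, +oo[).
  by apply: measurable_funM.
rewrite setTI; apply/funext => x; rewrite /= in_itv/= andbT.
rewrite (_ : votes x = (\sum_(S : {set 'I_V} | #|S| == m) bad S x)%:R).
  by rewrite -natrM ler_nat.
rewrite natr_sum big_mkcond; apply: eq_bigr => S _.
by case: (#|S| == m); rewrite ?mul1r ?mul0r.
Qed.

(* Hoeffding's decoupling: the uniform law on the m-subsets of the blocks is the
   average over the permutations s of the uniform laws on r * 2 disjoint
   m-subsets, whose votes are independent. *)
Lemma majority_vote :
  (Pn [set x | (#|[set S : {set 'I_V} | #|S| == m]%SET| <=
                2 * \sum_(S : {set 'I_V} | #|S| == m) bad S x)%N] <=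
   (((1 + q) ^+ 2 / 2) ^+ r)%:E)%E.
Proof.
set E := [set x | _].
(* The V blocks are read as the entries of a matrix with r * 2 rows and m columns; each row is one
   of the disjoint m-subsets. *)
pose block (j : 'I_(r * 2)) : {set 'I_V} :=
  [set cast_ord (esym V_blocks) (mxvec_index j l) | l : 'I_m]%SET.
have block_inj j j' (l l' : 'I_m) :
    cast_ord (esym V_blocks) (mxvec_index j l) =
    cast_ord (esym V_blocks) (mxvec_index j' l') ->
    (j, l) = (j', l').
  have [g gK _] := curry_mxvec_bij (r * 2) m.
  move=> /cast_ord_inj e.
  by rewrite -(gK (j, l)) ?finset.inE// -(gK (j', l')) ?finset.inE//= e.
have card_block j : #|block j| = m.
  by rewrite card_imset ?card_ord// => l l' /block_inj[].
have card_sblock (s : {perm 'I_V}) j : #|(s @: block j)%SET| = m.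
  by rewrite card_imset//; exact: perm_inj.
pose D (s : {perm 'I_V}) j := (\bigcup_(K in s @: block j) B K)%SET.
have disjointD s i j c : i != j -> c \in D s i -> c \notin D s j.
  move=> ij /bigcupP[_ /imsetP[_ /imsetP[l _ ->] ->] cB].
  apply/bigcupP => -[_ /imsetP[_ /imsetP[l' _ ->] ->]]; apply/negP.
  apply: disjointB cB; apply: contraNneq ij => /perm_inj/block_inj[-> _].
  by rewrite eqxx.
pose votes (s : {perm 'I_V}) x := (\sum_(j < r * 2) bad (s @: block j)%SET x)%N.
(* This is V! times the permutation average of 2^votes. Since 2^b = 1 + b for a vote b in {0, 1},
   each summand is a product of independent factors. *)
pose mgf x : R := \sum_(s : {perm 'I_V}) \prod_(j < r * 2)
  (1 + (bad (s @: block j)%SET x)%:R).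
have mgfE x : mgf x = \sum_(s : {perm 'I_V}) 2 ^+ votes s x.
  apply: eq_bigr => s _; rewrite /votes -prodrXr; apply: eq_bigr => j _.
  by case: bad; rewrite /= ?addr0.
have mgf_ge x : E x -> 2 ^+ r * V`!%:R <= mgf x.
  rewrite /E/= => Ex; rewrite mgfE.
  have votes_ge : (r * V`! <= \sum_(s : {perm 'I_V}) votes s x)%N.
    have [->//|r_gt0] := posnP r.
    have j0 : 'I_(r * 2) by apply: Ordinal (_ : 0 < _)%N; rewrite muln_gt0 r_gt0.
    (* The number of m-subsets is about to be cancelled; a row of the matrix shows that it is
       positive. *)
    have J0 : (0 < #|[set S : {set 'I_V} | #|S| == m]%SET|)%N.
      by apply/card_gt0P; exists (block j0); rewrite finset.inE card_block.
    rewrite -(leq_pmul2r J0) exchange_big/= big_distrl/=.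
    under eq_bigr => j _.
      rewrite -(card_block j) (sum_perm_imset (block j) (fun S => bad S x : nat)).
      rewrite card_ord card_block.
      over.
    rewrite sum_nat_const card_ord.
    have -> : (r * 2 * (V`! * \sum_(S : {set 'I_V} | #|S| == m) bad S x) =
      r * V`! * (2 * \sum_(S : {set 'I_V} | #|S| == m) bad S x))%N by lia.
    by rewrite leq_mul2l Ex orbT.
  apply: (@le_trans _ _
      (\sum_(s : {perm 'I_V}) 2 ^+ r * (1 + (votes s x)%:R - r%:R))).
    rewrite -mulr_sumr ler_pM2l ?exprn_gt0// sumrB big_split/= !sumr_const.
    rewrite card_permT card_ord -natr_sum -(ler_nat R) in votes_ge *.
    rewrite -[r%:R *+ _]mulr_natr -natrM.
    by lra.
  by apply: ler_sum => s _; exact: expr2_ge_linear.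
have mE : measurable E := measurable_majority.
have m1bad S : measurable_fun setT (fun x => 1 + (bad S x)%:R : R).
  by apply: measurable_funD => //; exact: measurable_bad.
have mean_le (S : {set 'I_V}) : #|S| = m ->
    exists2 v : R, (\int[Pn]_x (1 + (bad S x)%:R)%:E = v%:E)%E & 0 <= v <= 1 + q.
  move=> Sm; have := bad_le Sm; set N := [set x | _] => Nq.
  have mN : measurable N.
    have -> : N = setT `&` (bad S @^-1` [set true]) by rewrite setTI.
    exact: mbad.
  have Nfin : Pn N \is a fin_num by exact: fin_num_measure.
  exists (1 + fine (Pn N)); last first.
    rewrite addr_ge0 ?fine_ge0//= lerD2l -lee_fin fineK//.
  under eq_integral do rewrite EFinD.
  rewrite ge0_integralD//; last by apply/measurable_EFinP; exact: measurable_bad.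
  rewrite integral_cst// EFinD mul1e fineK//; congr (_ + _)%E.
    exact: probability_setT.
  rewrite -[in RHS](setIT N) -integral_indic//; apply: eq_integral => x _.
  by rewrite indicE mem_setE.
have mprod (t : {perm 'I_V}) : measurable_fun setT
    (fun x => \prod_(j < r * 2) (1 + (bad (t @: block j)%SET x)%:R) : R).
  exact: measurable_prod.
have mmgf : measurable_fun setT (fun x => (mgf x)%:E).
  by apply/measurable_EFinP; exact: measurable_sum.
have prod_ge0 (t : {perm 'I_V}) x :
    0 <= \prod_(j < r * 2) (1 + (bad (t @: block j)%SET x)%:R) :> R.
  by rewrite prodr_ge0// => j _; rewrite addr_ge0.
have mgf_le : (\int[Pn]_x (mgf x)%:E <= (V`!%:R * (1 + q) ^+ (r * 2))%:E)%E.
  under eq_integral do rewrite /mgf -sumEFin.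
  rewrite ge0_integral_sum//; last 2 first.
  - by move=> s; exact/measurable_EFinP.
  - by move=> s x _; rewrite lee_fin.
  apply: (@le_trans _ _ (\sum_(s : {perm 'I_V}) ((1 + q) ^+ (r * 2))%:E)%E).
    apply: lee_sum => s _.
    rewrite (@integral_prod_independent _ _ (D s))//; last 3 first.
    - exact: index_enum_uniq.
    - exact: disjointD.
    - by move=> j x y xy; rewrite (badB xy).
    have /all_sig2[v vE v_le] := fun j => cid2 (mean_le _ (card_sblock s j)).
    under eq_bigr do rewrite vE.
    have -> : (1 + q) ^+ (r * 2) = \prod_(j < r * 2) (1 + q).
      by rewrite prodr_const card_ord.
    by rewrite prodEFin lee_fin; apply: ler_prod.
  by rewrite sumEFin sumr_const card_permT card_ord lee_fin mulr_natl.
have V0 : 0 < V`!%:R :> R by rewrite ltr0n fact_gt0.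
have r0 : 0 < 2 ^+ r :> R by rewrite exprn_gt0.
(* Markov's inequality for [mgf], which is at least 2^r V! on E. *)
suff : ((2 ^+ r * V`!%:R)%:E * Pn E <= (V`!%:R * (1 + q) ^+ (r * 2))%:E)%E.
  rewrite -[Pn E]fineK ?fin_num_measure// -EFinM !lee_fin => PE.
  rewrite expr_div_n ler_pdivlMr// -exprM mulnC.
  by rewrite -(ler_pM2l V0); lra.
apply: le_trans mgf_le.
rewrite -integral_cst//.
apply: (@le_trans _ _ (\int[Pn]_(x in E) (mgf x)%:E)%E).
  apply: ge0_le_integral => //.
  - by move=> x _; rewrite lee_fin mulr_ge0 ?ltW.
  - exact: measurable_funTS.
apply: ge0_subset_integral => // x _.
by rewrite lee_fin sumr_ge0.
Qed.

End majority_vote.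

(** * The block statistics *)

(** The strict deviation and the form q t^p of the moment bound keep the case t = 0, which arises
    when M_p = 0: then u vanishes almost everywhere. For t > 0 this is Markov's inequality for
    |u|^p. *)
Lemma markov_powR d (Y : measurableType d) (R : realType) (mu : probability Y R)
    (u : Y -> R) (p t q : R) : measurable_fun setT u -> 0 < p -> 0 <= t ->
  (\int[mu]_y (`|u y| `^ p)%:E <= (q * t `^ p)%:E)%E -> 0 <= q ->
  (mu [set y | (t < `|u y|)%R] <= q%:E)%E.
Proof.
move=> mu_ p0 t0 uq q0; set E := [set y | _].
have mE : measurable E.
  rewrite (_ : E = setT `&` (fun y => `|u y|) @^-1` [set` `]t, +oo[%R]).
    by apply: (measurableT_comp _ mu_).
  by rewrite setTI; apply/funext => y; rewrite /E/= in_itv/= andbT.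
have mup : measurable_fun setT (fun y => (`|u y| `^ p)%:E).
  apply/measurable_EFinP; apply: (measurableT_comp (measurable_powR p)).
  exact: measurableT_comp.
move: t0; rewrite le0r => /predU1P[t0|t0].
  have /ae_eq_integral_abs : (\int[mu]_y `|(`|u y| `^ p)%:E| = 0)%E.
    apply/eqP; rewrite eq_le integral_ge0// andbT.
    move: uq; rewrite t0 powR0 ?gt_eqF// mulr0; apply: le_trans.
    rewrite le_eqVlt; apply/orP; left; apply/eqP; apply: eq_integral => y _.
    by rewrite gee0_abs// lee_fin powR_ge0.
  move=> /(_ measurableT mup) [N [mN N0 EN]].
  apply: le_trans (_ : mu N <= _)%E; last by rewrite N0 lee_fin.
  apply: le_measure; rewrite ?inE//.
  apply: subset_trans EN => y; rewrite /E t0/= normr_gt0 => uy0 /(_ I)[].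
  by move/eqP; rewrite powR_eq0 normr_eq0 (negbTE uy0).
have tp0 : 0 < t `^ p by rewrite powR_gt0.
suff : ((t `^ p)%:E * mu E <= (q * t `^ p)%:E)%E.
  rewrite -[mu E]fineK ?fin_num_measure// -EFinM !lee_fin mulrC.
  by rewrite ler_pM2r.
apply: le_trans uq; rewrite -integral_cst//.
apply: (@le_trans _ _ (\int[mu]_(y in E) (`|u y| `^ p)%:E)%E).
  apply: ge0_le_integral => //.
  - by move=> y _; rewrite lee_fin powR_ge0.
  - exact: measurable_funTS.
  - move=> y Ey; rewrite lee_fin ge0_ler_powR// ?nnegrE//; exact: ltW.
by apply: ge0_subset_integral => // y _; rewrite lee_fin powR_ge0.
Qed.

Section sample_law.
Context (d d' : measure_display) (Omega : measurableType d)
  (T : measurableType d') (R : realType).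
Variables (Pr : probability Omega R) (P : probability T R) (n : nat).
Variables (X : nat -> {RV Pr >-> T}).
Hypothesis iidX : iid_with_law n X P.

Definition sample (w : Omega) : n.-tuple T := [tuple X i w | i < n].

Lemma measurable_sample : measurable_fun setT sample.
Proof.
apply/measurable_fun_tnthP => i.
rewrite (_ : _ \o _ = X i); first exact: measurable_funPT.
by apply/funext => w /=; rewrite tnth_mktuple.
Qed.

Lemma sample_rectangle (A : 'I_n -> set T) : (forall i, measurable (A i)) ->
  Pr (sample @^-1` rectangle A) = (\prod_(i < n) P (A i))%E.
Proof.
move=> mA; have [X_P X_indep] := iidX.
have -> : sample @^-1` rectangle A =
    \bigcap_(i in [set` [set: 'I_n]%SET]) (X i @^-1` A i).
  apply/seteqP; split => [w wA i _|w wA i]; first by have := wA i; rewrite tnth_mktuple.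
  by rewrite tnth_mktuple; apply: wA; rewrite /= inE.
rewrite X_indep//; apply: eq_big => [i|i _]; first by rewrite inE.
exact: X_P.
Qed.

End sample_law.

Lemma powR_prod (R : realType) (I : finType) (f : I -> R) (p : R) :
  (forall i, 0 <= f i) -> (\prod_i f i) `^ p = \prod_i f i `^ p.
Proof.
move=> f0; suff [] : 0 <= \prod_i f i /\
  (\prod_i f i) `^ p = \prod_i f i `^ p by [].
elim/big_rec2: _ => [|i y x _ [x0 xy]]; first by rewrite powR1.
by rewrite mulr_ge0// powRM// xy.
Qed.

(** The exponents of 2 and of m are compared separately. Those of 2 require (2m - 1) p <= 5m - 4,
    which follows from p <= 2 <= m and is an equality at p = m = 2; those of m require m (p - 1) <=
    m p / 2, that is, p <= 2. *)
Lemma moment_constant (R : realType) (m : nat) (p : R) : (2 <= m)%N -> 1 < p <= 2 ->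
  2 ^+ m * (64 * m%:R) `^ (m%:R * (p - 1)) <=
  1 / 16 * (2 ^+ (4 * m + 1) * m%:R `^ (m%:R / 2)) `^ p :> R.
Proof.
move=> m2 /andP[p1 p2].
have m2R : 2 <= m%:R :> R by rewrite ler_nat.
have two_n (k : nat) : 2 ^+ k = 2 `^ k%:R :> R by rewrite powR_mulrn.
have -> : 64 = 2 `^ 6 :> R by rewrite -two_n; lra.
have -> : 1 / 16 = 2 `^ (- 4) :> R by rewrite powRN -two_n; lra.
rewrite !two_n !powRM ?powR_ge0//.
rewrite -!powRrM mulrA -powRD; last by rewrite pnatr_eq0 implybT.
rewrite [leRHS]mulrA -powRD; last by rewrite pnatr_eq0 implybT.
apply: ler_pM; rewrite ?powR_ge0//.
  rewrite ler_powR//; first by lra.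
  rewrite natrD natrM.
  have : (2 * m%:R - 1) * (2 - p) >= 0 by apply: mulr_ge0; lra.
  by lra.
by rewrite ler_powR//; nra.
Qed.

(** The left-hand side factors over the blocks, and each factor satisfies b^(-p) (2b - 1) <= 2
    b^(-(p-1)) <= 2 (64 m lambda)^(p-1). The product of these bounds carries lambda to the power m
    (p - 1), the p-th power of the claimed rate. *)
Lemma block_moment_le (R : realType) (m : nat) (p lambda M : R) (b : 'I_m -> nat) :
  (2 <= m)%N -> 1 < p <= 2 -> 0 < lambda -> 0 <= M -> (forall j, 0 < b j)%N ->
  (forall j, 1 <= 64 * m%:R * lambda * (b j)%:R) ->
  ((\prod_j (b j)%:R)^-1) `^ p * ((\prod_j (2 * b j - 1)%N)%:R * M `^ p) <=
  1 / 16 * (2 ^+ (4 * m + 1) * m%:R `^ (m%:R / 2) * M *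
            lambda `^ (m%:R * (p - 1) / p)) `^ p.
Proof.
move=> m2 p12 l0 M0 b0 bl.
have [p1 p2] : 1 < p /\ p <= 2 by case/andP: p12.
have Km0 : 0 <= 2 ^+ (4 * m + 1) * m%:R `^ (m%:R / 2) :> R.
  by rewrite mulr_ge0 ?powR_ge0 ?exprn_ge0.
rewrite !(powRM _ (mulr_ge0 Km0 M0)) ?powR_ge0//.
rewrite (powRM _ Km0)// -powRrM divfK; last by apply/eqP; lra.
rewrite [leLHS]mulrA [leRHS]mulrA [X in _ <= X * _]mulrA.
rewrite [leRHS]mulrAC ler_wpM2r ?powR_ge0//.
set e := m%:R * (p - 1).
apply: le_trans (_ : 2 ^+ m * (64 * m%:R) `^ e * lambda `^ e <= _); last first.
  by rewrite ler_wpM2r ?powR_ge0//; exact: moment_constant.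
rewrite -mulrA -powRM ?mulr_ge0//; last exact: ltW.
rewrite /e mulrC.
have -> : 2 ^+ m * (64 * m%:R * lambda) `^ (m%:R * (p - 1)) =
    \prod_(j < m) (2 * (64 * m%:R * lambda) `^ (p - 1)).
  rewrite prodr_const card_ord exprMn; congr (_ * _).
  by rewrite -powR_mulrn ?powR_ge0// -powRrM (mulrC (p - 1)).
have prod_powR : (\prod_j (b j)%:R)^-1 `^ p = \prod_j ((b j)%:R^-1 `^ p) :> R.
  rewrite -prodfV; apply: powR_prod => j.
  by rewrite invr_ge0.
rewrite prod_powR natr_prod -big_split/=; apply: ler_prod => j _.
rewrite mulr_ge0 ?powR_ge0//=.
have bj0 : 0 < (b j)%:R :> R by rewrite ltr0n.
apply: le_trans (_ : 2 * (b j)%:R * (b j)%:R^-1 `^ p <= _).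
  rewrite ler_wpM2r ?powR_ge0// -natrM ler_nat; lia.
rewrite -mulrA ler_pM2l//.
have -> : (b j)%:R * (b j)%:R^-1 `^ p = (b j)%:R^-1 `^ (p - 1).
  rewrite -(@mulr_powRB1 _ (b j)%:R^-1 p) ?invr_ge0//; last lra.
  by rewrite mulrA divff ?mul1r// gt_eqF.
apply: ge0_ler_powR; rewrite ?nnegrE ?invr_ge0//; first by lra.
  by apply: mulr_ge0; [rewrite mulr_ge0|exact: ltW].
by rewrite -div1r ler_pdivrMr.
Qed.

Lemma card_tuples_in (n m : nat) (C : 'I_m -> {set 'I_n}) :
  (\sum_(k : m.-tuple 'I_n | [forall j, tnth k j \in C j]) 1 =
   \prod_(j < m) #|C j|)%N.
Proof.
under [RHS]eq_bigr do rewrite -sum1_card.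
rewrite bigA_distr_big_dep/=.
rewrite (reindex (fun f : {ffun 'I_m -> 'I_n} => [tuple f j | j < m])).
  apply: eq_big => [f|f _]; last by rewrite big1.
  by apply/forallP/familyP => fC j; have := fC j; rewrite tnth_mktuple.
exists (fun k : m.-tuple 'I_n => [ffun j => tnth k j]) => [f _|k _].
  by apply/ffunP => j; rewrite ffunE tnth_mktuple.
by apply: eq_from_tnth => j; rewrite tnth_mktuple ffunE.
Qed.

Section block_tail.
Context (d : measure_display) (T : measurableType d) (R : realType).
Variables (P : probability T R) (n V m : nat) (B : 'I_V -> {set 'I_n}).
Variables (h : m.-tuple T -> R) (mh p lambda M : R).
Local Notation Pn := (power_probability P n).

Lemma block_statisticB (i : m.-tuple 'I_V) (x : n.-tuple T) :
  (forall j, 0 < #|B (tnth i j)|)%N ->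
  block_statistic B h (tnth x) i - mh =
  (\prod_(j < m) #|B (tnth i j)|%:R)^-1 *
  block_sum (fun y => h y - mh) (fun j => B (tnth i j)) x.
Proof.
move=> B0; rewrite /block_statistic /block_sum sumrB mulrBr; congr (_ - _).
rewrite -[mh]mul1r -mulr_suml mulrA.
have -> : \sum_(k : m.-tuple 'I_n | [forall j, tnth k j \in B (tnth i j)]) 1 =
    \prod_(j < m) #|B (tnth i j)|%:R :> R.
  by rewrite -natr_prod -card_tuples_in natr_sum.
rewrite mulVf ?mul1r// prodf_seq_neq0; apply/allP => j _.
by rewrite pnatr_eq0 -lt0n B0.
Qed.

Lemma measurable_block_statistic i : measurable_fun setT h ->
  measurable_fun setT (fun x : n.-tuple T => block_statistic B h (tnth x) i).
Proof.
move=> mh'; apply: measurable_funM => //.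
exact: (@measurable_block_sum _ _ _ n m h mh' (fun j => B (tnth i j))).
Qed.

Hypothesis p12 : 1 < p <= 2.
Hypothesis m2 : (2 <= m)%N.
Hypothesis h_sym : symmetric_kernel h.
Hypothesis h_meas : measurable_fun setT h.
Hypothesis h_canonical : P_canonical P (fun x => h x - mh).
Hypothesis disjointB : forall K L c, K != L -> c \in B K -> c \notin B L.
Hypothesis lambda0 : 0 < lambda.
Hypothesis cardB : forall K, 1 <= 64 * m%:R * lambda * #|B K|%:R.
Hypothesis M0 : 0 <= M.
Hypothesis h_moment :
  (\int[power_probability P m]_x (`|h x - mh| `^ p)%:E <= (M `^ p)%:E)%E.

Lemma block_statistic_tail (i : m.-tuple 'I_V) : uniq i ->
  (Pn [set x | (2 ^+ (4 * m + 1) * m%:R `^ (m%:R / 2) * M *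
                lambda `^ (m%:R * (p - 1) / p) <
                `|block_statistic B h (tnth x) i - mh|)%R] <= (1 / 16)%:E)%E.
Proof.
move=> i_uniq.
have B0 K : (0 < #|B K|)%N.
  rewrite lt0n; apply: contraTneq (cardB K) => ->.
  by rewrite mulr0 -ltNge.
have g_section x : kernel_section_mean P (fun x => h x - mh) (x : m.-1.-tuple T) = 0%E.
  by have [g0 [_ gx _]] := h_canonical; rewrite gx.
have g_sym : symmetric_kernel (fun x => h x - mh).
  by move=> s x; rewrite h_sym.
have g_meas : measurable_fun setT (fun x => h x - mh).
  by apply: measurable_funB.
apply: (markov_powR (p := p)) => //.
- apply: measurable_funB => //; exact: measurable_block_statistic.
- by case/andP: p12 => p1 _; lra.
- by rewrite !mulr_ge0 ?powR_ge0.
under eq_integral do rewrite block_statisticB//.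
set c := (\prod_j _)^-1.
have c0 : 0 <= c by rewrite invr_ge0 prodr_ge0.
under eq_integral do rewrite normrM (ger0_norm c0) powRM// EFinM.
rewrite ge0_integralZl_EFin ?powR_ge0//; last first.
  apply/measurable_EFinP; apply: (measurableT_comp (measurable_powR p)).
  apply: measurableT_comp => //; exact: measurable_block_sum.
have C_disj j j' e : j != j' -> e \in B (tnth i j) -> e \notin B (tnth i j').
  by move=> jj'; apply: disjointB; rewrite (inj_eq (tuple_uniqP _ i_uniq)).
have := integral_block_sum_powR p12 g_sym g_meas (ltnW m2) g_section C_disj h_moment.
move=> /(lee_wpmul2l (_ : 0 <= (c `^ p)%:E)%E) moment.
apply: le_trans (moment _) _; first by rewrite lee_fin powR_ge0.
by rewrite -EFinM lee_fin; exact: block_moment_le.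
Qed.

End block_tail.

(** * Increasing tuples, m-subsets and medians *)

Section increasing_tuples.
Variables (V m : nat) (K0 : 'I_V).

(* The default value K0 only occurs if S has fewer than m elements. *)
Definition sorted_tuple (S : {set 'I_V}) : m.-tuple 'I_V :=
  [tuple nth K0 (enum S) j | j < m].

Lemma sorted_tupleE (S : {set 'I_V}) : #|S| = m -> sorted_tuple S = enum S :> seq _.
Proof.
move=> Sm; have sz : size (enum S) = m by rewrite -cardE.
apply: (@eq_from_nth _ K0) => [|j]; rewrite size_tuple ?sz// => jm.
by rewrite -[j]/(nat_of_ord (Ordinal jm)) -tnth_nth tnth_mktuple.
Qed.

Lemma sorted_enum_set (S : {set 'I_V}) : sorted ltn [seq val j | j <- enum S].
Proof.
rewrite sorted_map /enum_mem -enumT; apply: sorted_filter.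
  by move=> y x z; exact: ltn_trans.
by rewrite -sorted_map val_enum_ord iota_ltn_sorted.
Qed.

Lemma increasing_uniq (i : m.-tuple 'I_V) : i \in increasing_indices m V -> uniq i.
Proof.
rewrite inE => isort; rewrite -(map_inj_uniq val_inj).
exact: (sorted_uniq ltn_trans ltnn).
Qed.

(** The median ranges over increasing tuples, whereas a permutation of the blocks acts on m-subsets
    and does not preserve monotonicity; this identity passes from one indexing to the other. *)
Lemma sum_increasing (f : m.-tuple 'I_V -> nat) :
  (\sum_(i in increasing_indices m V) f i =
   \sum_(S : {set 'I_V} | #|S| == m) f (sorted_tuple S))%N.
Proof.
rewrite (reindex_onto sorted_tuple (fun i : m.-tuple 'I_V => [set K in i]%SET)).
  apply: eq_bigl => S; apply/andP/eqP => [[iS /eqP SE]|Sm].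
    by rewrite -SE cardsE (card_uniqP (increasing_uniq iS)) size_tuple.
  split; first by rewrite inE sorted_tupleE// sorted_enum_set.
  apply/eqP/finset.setP => K; rewrite finset.inE.
  rewrite -[K \in sorted_tuple S]/(K \in tval (sorted_tuple S)).
  by rewrite sorted_tupleE// mem_enum.
move=> i i_inc; apply: val_inj.
have i_card : #|[set K in i]%SET| = m.
  by rewrite cardsE (card_uniqP (increasing_uniq i_inc)) size_tuple.
rewrite /= sorted_tupleE//; apply: (inj_map val_inj).
apply: (irr_sorted_eq ltn_trans ltnn).
- exact: sorted_enum_set.
- by move: i_inc; rewrite inE.
move=> K; apply/mapP/mapP => -[K' K'i ->]; exists K' => //.
  by move: K'i; rewrite mem_enum finset.inE.
by rewrite mem_enum finset.inE.
Qed.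

Lemma card_increasing :
  #|increasing_indices m V| = #|[set S : {set 'I_V} | #|S| == m]%SET|.
Proof. by rewrite -sum1_card sum_increasing sum1dep_card. Qed.

Lemma sorted_tuple_uniq (S : {set 'I_V}) : #|S| = m -> uniq (sorted_tuple S).
Proof. by move=> Sm; rewrite sorted_tupleE// enum_uniq. Qed.

Lemma mem_sorted_tuple (S : {set 'I_V}) j :
  #|S| = m -> tnth (sorted_tuple S) j \in S.
Proof. by move=> Sm; rewrite -mem_enum -(sorted_tupleE Sm) mem_tnth. Qed.

End increasing_tuples.

(** On whichever side of c the median b lies, the values beyond b on that side are at least as far
    from c, and they make up at least half of all values. *)
Lemma median_deviation (R : realType) (J : finType) (I : {set J}) (a : J -> R)
    (b c t : R) : is_median I a b -> t < `|b - c| ->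
  (#|I| <= 2 * \sum_(i in I) (t < `|a i - c|)%R)%N.
Proof.
move=> [le_b ge_b] tb.
have card_le (Q : pred J) : (forall i, Q i -> t < `|a i - c|) ->
    #|I|%:R / 2 <= #|[set i in I | Q i]%SET|%:R :> R ->
    (#|I| <= 2 * \sum_(i in I) (t < `|a i - c|)%R)%N.
  move=> Qt IQ; rewrite -(ler_nat R) natrM.
  apply: le_trans (_ : 2 * #|[set i in I | Q i]%SET|%:R <= _); first lra.
  rewrite ler_pM2l// ler_nat -sum1_card.
  under eq_bigl do rewrite finset.in_set.
  rewrite big_mkcondr/=; apply: leq_sum => i _.
  by case: ifP => // /Qt ->.
move: tb; have [bc|cb] := leP b c => tb.
  apply: card_le le_b => i ab; apply: lt_le_trans tb _.
  by rewrite !ler0_norm; lra.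
apply: card_le ge_b => i ab; apply: lt_le_trans tb _.
by rewrite !ger0_norm; lra.
Qed.

(** * Final constants and assembly *)

Lemma expRN_ge (R : realType) (l : nat) : (1 / 4) ^+ l <= expR (- l%:R) :> R.
Proof.
have -> : expR (- l%:R) = expR (- 1) ^+ l :> R.
  by rewrite -expRM_natl mulrN1.
rewrite lerXn2r ?nnegrE ?expR_ge0//.
(* Halving the exponent makes 1 + x <= e^x useful: e^(-1/2) >= 1/2, whose square is the claim, while
   x = -1 would only give e^(-1) >= 0. *)
have -> : -1 = - (1 / 2) + - (1 / 2) :> R by lra.
rewrite expRD; have := expR_ge1Dx (- (1 / 2) : R).
by nra.
Qed.

(** The majority bound with q = 1/16 and r = 16 l: the 16th power of (17/16)^2 / 2 is below 1/4, so
    the whole is at most 4^(-l) <= e^(-l). *)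
Lemma majority_bound_le (R : realType) (delta : R) (l : nat) :
  0 < delta -> ln delta^-1 <= l%:R ->
  ((1 + 1 / 16) ^+ 2 / 2) ^+ (16 * l) <= delta.
Proof.
move=> delta0 lnd.
have : expR (- l%:R) <= delta.
  by rewrite -[leRHS]lnK// ler_expR lerNl -lnV.
apply: le_trans; apply: le_trans (expRN_ge R l).
by rewrite exprM lerXn2r ?nnegrE//; lra.
Qed.

Lemma partition_disjoint (n V : nat) (B : 'I_V -> {set 'I_n}) :
  ordered_partition B -> forall K L c, K != L -> c \in B K -> c \notin B L.
Proof.
move=> [B_inj /and3P[_ /finset.trivIsetP dB _]] K L c KL cK.
have := dB (B K) (B L) (imset_f _ isT) (imset_f _ isT).
by rewrite (inj_eq B_inj) => /(_ KL)/disjointFr ->.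
Qed.

Theorem theorem3 (d d' : measure_display) (Omega : measurableType d)
    (T : measurableType d') (R : realType)
    (Pr : probability Omega R) (P : probability T R)
    (m n : nat) (X : nat -> {RV Pr >-> T}) (h : m.-tuple T -> R)
    (p delta : R) (V : nat) (B : 'I_V -> {set 'I_n}) (Ubar : Omega -> R) :
  let mh : R := fine ('E_Pr[fun w => h [tuple X i w | i < m]])%E in
  let Mp : \bar R :=
    Lnorm Pr p%:E (fun w => (h [tuple X i w | i < m] - mh)%:E) in
  let L : int := Num.ceil (ln delta^-1) in
  let Km : R := 2 ^+ (4 * m + 1) * m%:R `^ (m%:R / 2) in
  (2 <= m)%N ->
  iid_with_law n X P ->
  measurable_fun [set: m.-tuple T] h ->
  symmetric_kernel h ->
  P_canonical P (fun x => h x - mh) ->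
  1 < p <= 2 ->
  (Mp < +oo)%E ->
  0 < delta < 1 / 2 ->
  L%:~R <= n%:R / (64 * m%:R) :> R ->
  V%:Z = 32 * m%:Z * L ->
  regular_partition R B ->
  (forall w, is_robust_estimate B h (fun k : 'I_n => X k w) (Ubar w)) ->
  with_probability_at_least Pr (1 - 2 * delta)
    [set w | `|Ubar w - mh| <=
       Km * fine Mp * (L%:~R / n%:R) `^ (m%:R * (p - 1) / p)].
Proof.
move=> mh Mp L Km m2 iid h_meas h_sym h_canonical p12 Mp_fin.
move=> /andP[delta0 delta_half] L_le V_E B_reg Ubar_med.
have lnd_gt0 : 0 < ln delta^-1.
  by rewrite ln_gt0// -div1r ltr_pdivlMr//; lra.
have L_gt0 : 0 < L by rewrite -ceil_gt0 in lnd_gt0 *.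
have [l LE] : exists l : nat, L = l by exists `|L|%N; rewrite gtz0_abs.
have l_gt0 : (0 < l)%N by move: L_gt0; rewrite LE.
have m_gt0 : 0 < m%:R :> R by rewrite ltr0n ltnW.
have lR_gt0 : 0 < l%:R :> R by rewrite ltr0n.
(* The shape r * 2 * m expected by the majority vote, with r = 16 l. *)
have VE : V = (16 * l * 2 * m)%N.
  by apply/eqP; rewrite -eqz_nat V_E LE; apply/eqP; lia.
have n_ge : 64 * m%:R * l%:R <= n%:R :> R.
  by move: L_le; rewrite LE ler_pdivlMr ?mulr_gt0//= mulrC.
have n_gt0 : 0 < n%:R :> R by apply: lt_le_trans n_ge; rewrite !mulr_gt0.
have mn : (m <= n)%N.
  rewrite -(ler_nat R); apply: le_trans n_ge.
  have : 1 <= l%:R :> R by rewrite ler1n.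
  by nra.
pose lambda : R := l%:R / n%:R.
have lambda0 : 0 < lambda by rewrite divr_gt0.
pose M := fine Mp.
have M0 : 0 <= M by apply: fine_ge0; exact: Lnorm_ge0.
have [p1 p2] : 1 < p /\ p <= 2 by case/andP: p12.
(* [Mp] is a norm on [Omega]. It becomes a moment under P^m by way of the law of the whole sample
   and its first m coordinates, which exist because m <= n. *)
have moment : (\int[power_probability P m]_x (`|h x - mh| `^ p)%:E <= (M `^ p)%:E)%E.
  have Mp_powR : (M `^ p)%:E =
      (\int[Pr]_w (`|h [tuple X i w | i < m] - mh| `^ p)%:E)%E.
    rewrite -poweR_EFin /M fineK; last first.
      by rewrite ge0_fin_numE// Lnorm_ge0.
    by rewrite poweR_Lnorm//; lra.
  rewrite Mp_powR.
  pose f (x : m.-tuple T) := (`|h x - mh| `^ p)%:E.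
  have mf : measurable_fun setT f.
    apply/measurable_EFinP; apply: (measurableT_comp (measurable_powR p)).
    by apply: measurableT_comp => //; exact: measurable_funB.
  pose k := widen_ord mn.
  have k_inj : injective k by move=> i j /(congr1 val)/= ij; exact: val_inj.
  rewrite -(integral_subtuple P k_inj mf).
  rewrite (integral_power_probability (measurable_sample (n := n) X)
    (sample_rectangle iid)); last first.
    exact: (measurableT_comp mf (measurable_subtuple k)).
  rewrite le_eqVlt; apply/orP; left; apply/eqP; apply: eq_integral => w _.
  congr ((`|h _ - _| `^ p)%:E); apply: eq_from_tnth => i.
  by rewrite tnth_subtuple !tnth_mktuple.
have disjointB := partition_disjoint B_reg.1.
(* Regularity gives #|B K| >= x - 1 with x = n / V, and x >= 2 makes this at least x / 2 = 1 / (64 m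
   lambda). *)
have cardB K : 1 <= 64 * m%:R * lambda * #|B K|%:R.
  have := B_reg.2 K; rewrite ler_distl => /andP[+ _].
  set x := n%:R / V%:R.
  have V_R : V%:R = 32 * m%:R * l%:R :> R.
    by rewrite VE !natrM; lra.
  have V_pos : 0 < V%:R :> R by rewrite V_R !mulr_gt0.
  have x_ge2 : 2 <= x by rewrite /x ler_pdivlMr// V_R; lra.
  have -> : 64 * m%:R * lambda = 2 / x.
    by rewrite /x /lambda V_R; field; rewrite !gt_eqF.
  move=> xB; rewrite mulrAC ler_pdivlMr; lra.
have V_gt0 : (0 < V)%N by rewrite VE !muln_gt0 l_gt0 (ltnW m2).
pose K0 := Ordinal V_gt0.
pose t := Km * M * lambda `^ (m%:R * (p - 1) / p).
have t_E : t = Km * fine Mp * (L%:~R / n%:R) `^ (m%:R * (p - 1) / p).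
  by rewrite /t /lambda LE.
(* The test on the size of S keeps the filler [K0] of [sorted_tuple] out, so that [bad S] depends
   only on the blocks in S for every set S. *)
pose bad (S : {set 'I_V}) (x : n.-tuple T) :=
  (#|S| == m) && (t < `|block_statistic B h (tnth x) (sorted_tuple m K0 S) - mh|).
have bad_meas S : measurable_fun setT (bad S).
  rewrite /bad; case: (#|S| == m); last exact: measurable_cst.
  apply: measurable_fun_ltr => //; apply: measurableT_comp => //.
  by apply: measurable_funB => //; exact: measurable_block_statistic.
have badB (S : {set 'I_V}) : depends_on (\bigcup_(K in S) B K)%SET (bad S).
  move=> x y xy; rewrite /bad; case: eqP => //= Sm.
  rewrite /block_statistic; congr (_ < `|_ * _ - _|).
  apply: eq_bigr => k /forallP kB; congr h; apply: eq_from_tnth => j.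
  rewrite !tnth_mktuple xy//; apply/bigcupP.
  exists (tnth (sorted_tuple m K0 S) j) => //.
  exact: mem_sorted_tuple.
have bad_le (S : {set 'I_V}) : #|S| = m ->
    (power_probability P n [set x | bad S x] <= (1 / 16)%:E)%E.
  move=> Sm; rewrite /bad Sm eqxx /=.
  exact: block_statistic_tail (sorted_tuple_uniq _ Sm).
have q0 : 0 <= 1 / 16 :> R by lra.
have majority := majority_vote VE disjointB bad_meas badB q0 bad_le.
set E := [set x | _] in majority.
have mE : measurable E by exact: measurable_majority.
have mS := measurable_sample (n := n) X.
have mSE : measurable (sample n X @^-1` E).
  by rewrite -[X in measurable X]setTI; exact: mS.
(* The event is defined by the votes and not by [Ubar], whose choice among the medians may fail to
   be measurable. *)
exists (~` (sample n X @^-1` E)); split.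
- exact: measurableC.
- move=> w /= wE; rewrite leNgt; apply/negP => dev; apply: wE.
  rewrite -t_E in dev.
  rewrite /E/= -(card_increasing _ K0).
  apply: leq_trans (median_deviation (Ubar_med w) dev) _.
  rewrite leq_mul2l (sum_increasing K0)/=; apply: leq_sum => S /eqP Sm.
  rewrite /bad Sm eqxx /=.
  have -> : tnth (sample n X w) = (fun k : 'I_n => X k w).
    by apply/funext => k; rewrite tnth_mktuple.
  exact: leqnn.
rewrite [X in (_ <= X)%E](probability_setC Pr mSE) EFinB.
rewrite leeB// (power_probability_preimage mS (sample_rectangle iid) mE).
apply: le_trans majority _; rewrite lee_fin.
apply: le_trans (majority_bound_le (l := l) delta0 _) _; last by lra.
by have := ceil_ge (ln delta^-1); rewrite -/L LE.
Qed.
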